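(* Let $\Lambda$, $(\Lambda_n)_{n\ge0}$, $F$, $\mu$, $r$ and $\varphi$ be the objects associated in the context to a finite family of contractions $f_1,\dots,f_s$ of $[0,1]$. Let $k\in\mathbb{N}$ and $T=F^k$, put $X_j=\varphi\circ T^j$ for $j\ge0$ and $M_N=\max\{X_0,\dots,X_{N-1}\}$. Let $\tau\ge0$, and for $n\in\mathbb{N}$ let $u_n=n+k-1$, $w_n=\lfloor\tau\,(\mu(\Lambda_{n+k-1}))^{-1}\rfloor$ and $U_n=\{X_0>u_n\}$. Assume that there exist a sequence $(t_n)_{n\in\mathbb{N}}$ with $t_n=o(w_n)$ and a sequence $(q_n)_{n\in\mathbb{N}}$ of positive integers with $q_n\to\infty$ and $q_n/w_n\to0$ such that, with $\mathcal{A}_{q_n,n}=\{X_0>u_n,\,X_1\le u_n,\dots,X_{q_n}\le u_n\}$, $$\lim_{n\to\infty}\|\mathbf{1}_{\mathcal{A}_{q_n,n}}\|_{BV}\,w_n\,r^{t_n}=0\qquad\text{and}\qquad \lim_{n\to\infty}\|\mathbf{1}_{U_n}\|_{BV}\,r^{q_n}=0 .$$ Assume moreover that there exists $0\le\theta\le1$ such that $$\theta=\lim_{n\to\infty}\frac{\mu(\Lambda_{n+k-1}\setminus\Lambda_{n+2k-1})}{\mu(\Lambda_{n+k-1})}.$$ Then $$\lim_{n\to\infty}\mu(M_{w_n}\le u_n)=e^{-\theta\tau}.$$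
   Context: $\mathbb{N}=\{1,2,\dots\}$. Let $f_1,\dots,f_s$ be maps $f_i:[0,1]\to[0,1]$, each a $C^1$ diffeomorphism onto its image $J_i=f_i([0,1])$, with $|f_i(x)-f_i(y)|\le\lambda_i|x-y|$ for some $\lambda_i<1$, and with $J_1,\dots,J_s$ pairwise disjoint. Define $G:\mathbb{R}\to\mathbb{R}$ by $G(x)=f_i^{-1}(x)$ if $x\in J_i$ and $G(x)=2$ otherwise. Let $\Lambda=\{x\in[0,1]: G^n(x)\in[0,1]\text{ for all }n\in\mathbb{N}\}$ (the dynamically defined Cantor set, which is the attractor of the iterated function system $\{f_1,\dots,f_s\}$). Let $\Lambda_0=[0,1]$ and, for $n\ge1$, $\Lambda_n=G^{-1}(\Lambda_{n-1})=\{x\in[0,1]:G^j(x)\in[0,1]\text{ for }j=1,\dots,n\}$, so $\Lambda=\bigcap_{n\ge0}\Lambda_n$. Observable: $\varphi(x)=n$ if $x\in\Lambda_{n-1}\setminus\Lambda_n$ ($n=1,2,3,\dots$) and $\varphi(x)=\infty$ if $x\in\Lambda$. Thus $\{\varphi>n\}=\Lambda_n$. Map $F:[0,1]\to[0,1]$: $F(x)=G(x)$ for $x\in\bigcup_{i=1}^sJ_i$, and on each connected component $I$ of $[0,1]\setminus\bigcup_iJ_i$, $F$ is an affine map sending $I$ onto $[0,1]$ (up to endpoints). For $\psi:[0,1]\to\mathbb{R}$, $\|\psi\|_{BV}=\sup|\psi|+\mathrm{Var}(\psi)$, where $\mathrm{Var}(\psi)=\sup\sum_{i=0}^{n-1}|\psi(x_{i+1})-\psi(x_i)|$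 over all finite ordered sequences $x_0\le\dots\le x_n$ in $[0,1]$; $BV$ is the space of functions with finite norm. Standing property: $\mu$ is an $F$-invariant probability measure absolutely continuous with respect to Lebesgue measure, with exponential decay of correlations of $BV$ against $L^1(\mu)$: there are constants $C>0$ and $0<r<1$ such that for all $\phi\in BV$, $\psi\in L^1(\mu)$ and $n\in\mathbb{N}$, $$\left|\int\phi\,(\psi\circ F^n)\,d\mu-\int\phi\,d\mu\int\psi\,d\mu\right|\le C\,r^n\,\|\phi\|_{BV}\,\|\psi\|_{L^1(\mu)}.$$ This is the $r$ appearing in the claim. The event $\{M_0\le u\}$ (maximum over an empty set) is understood to be the whole space. *)

(* Defs.v *)
From HB Require Import structures.
From mathcomp Require Import all_boot all_order all_algebra.
From mathcomp Require Import all_classical all_reals all_analysis.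

Set Implicit Arguments.
Unset Strict Implicit.
Unset Printing Implicit Defensive.

Import Order.TTheory GRing.Theory Num.Theory.
Import numFieldNormedType.Exports.

Local Open Scope classical_set_scope.
Local Open Scope ring_scope.

(* The dynamics lives on [0, 1], but maps and observables are functions on R:
   only their values on [0, 1] matter, and every set and integral below is
   restricted to [0, 1]. *)
Notation I01 := (`[0, 1]%classic).

Section Smoothness.
Context {R : realType}.
Implicit Types (D : set R) (f : R -> R).

(* The derivative is relative to D, hence one-sided at the endpoints when D is
   a compact interval. *)
Definition C1_on D f :=
  exists df : R -> R,
    {within D, continuous df} /\
    forall x, D x ->
      (f y - f x) / (y - x) @[y --> within D (dnbhs x)] --> df x.

Definition C1_diffeo_onto_image D f :=
  C1_on D f /\
  exists g : R -> R, C1_on (f @` D) g /\ forall x, D x -> g (f x) = x.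

End Smoothness.

Section CantorSet.
Context {R : realType} {s : nat}.
Variable f : 'I_s -> R -> R.

Definition J (i : 'I_s) : set R := f i @` I01.

Definition contracting_family :=
  [/\ forall i x, I01 x -> I01 (f i x),
      forall i, C1_diffeo_onto_image I01 (f i),
      forall i, exists2 lambda : R, lambda < 1 &
        forall x y, I01 x -> I01 y ->
          `|f i x - f i y| <= lambda * `|x - y| &
      forall i j, i != j -> J i `&` J j = set0].

(* The default value of the partial inverse is never used, since x \in J i. *)
Definition G (x : R) : R :=
  if [pick i | x \in J i] is Some i then 'pinv_(fun=> 2) I01 (f i) x else 2.

Definition Lambda : set R :=
  [set x | I01 x /\ forall n, (0 < n)%N -> I01 (iter n G x)].

Fixpoint Lambda_ (n : nat) : set R :=
  if n is n'.+1 then G @^-1` Lambda_ n' else I01.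

(* Outside [0, 1] no level exists and phi takes the irrelevant value 0. *)
Definition phi (x : R) : \bar R :=
  if x \in Lambda then +oo%E
  else (xget 0%N [set n | (0 < n)%N /\ (Lambda_ n.-1 `\` Lambda_ n) x])%:R%:E.

Definition gaps : set R := I01 `\` \bigcup_i J i.

(* The affine branch may be increasing or decreasing on each component I of
   the gaps; "onto [0, 1] up to endpoints" is ]0, 1[ <= F I <= [0, 1]. *)
Definition gap_extension (F : R -> R) :=
  (forall i x, J i x -> F x = G x) /\
  forall x, gaps x ->
    let I := connected_component gaps x in
    (exists a b : R, forall y, I y -> F y = a * y + b) /\
    `]0, 1[ `<=` F @` I /\ F @` I `<=` I01.

End CantorSet.

Section BoundedVariation.
Context {R : realType}.
Implicit Type psi : R -> R.
Local Open Scope ereal_scope.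

(* Adding the endpoints to an ordered sequence in [0, 1] and deleting its
   repetitions does not decrease its variation, so the supremum may be taken
   over partitions, as in total_variation. *)
Definition BVnorm psi : \bar R :=
  ereal_sup [set `|psi x|%:E | x in I01] + total_variation 0%R 1%R psi.

Definition BV psi := BVnorm psi < +oo.

End BoundedVariation.

Section InvariantMeasure.
Context {R : realType}.
Variable mu : probability (measurableTypeR R) R.

Definition invariant_measure (F : R -> R) :=
  forall A : set (measurableTypeR R), measurable A ->
    mu (I01 `&` F @^-1` A) = mu A.

Definition exp_decay (F : R -> R) (r : R) :=
  exists2 C : R, 0 < C & 0 < r < 1 /\
  forall (ph ps : measurableTypeR R -> R) (n : nat),
    BV ph -> mu.-integrable I01 (EFin \o ps) -> (0 < n)%N ->
    (`| \int[mu]_(x in I01) (ph x * ps (iter n F x))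
        - (\int[mu]_(x in I01) ph x) * (\int[mu]_(x in I01) ps x) |%:E
     <= (C * r ^+ n)%:E * BVnorm ph * \int[mu]_(x in I01) `|ps x|%:E)%E.

End InvariantMeasure.

Section ExtremeValues.
Context {R : realType}.
Variables (X : nat -> R -> \bar R).

(* The maximum over the empty set is -oo, so that {M 0 <= u} is everything. *)
Definition M (N : nat) (x : R) : \bar R := \big[maxe/-oo%E]_(j < N) X j x.

Definition exceedance (u : \bar R) : set R := [set x | I01 x /\ (u < X 0 x)%E].

Definition escape (q : nat) (u : \bar R) : set R :=
  [set x | [/\ I01 x, (u < X 0 x)%E &
             forall j, (1 <= j <= q)%N -> (X j x <= u)%E]].

End ExtremeValues.

(* Main.v *)
Require Import Defs.
From HB Require Import structures.
From mathcomp Require Import all_boot all_order all_algebra.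
From mathcomp Require Import all_classical all_reals all_analysis.
From mathcomp Require Import measurable_realfun.
From mathcomp Require Import ring lra zify.

(** The exceedance [phi (T ^ j x) > u_n] means that [T ^ j x] lies in the hole
    [U = Lambda_ m], where [m = n + k - 1]; so the theorem is a hitting time law
    for the holes [Lambda_ m], of measure [v m].

    Let [Q = Lambda_ m `\` Lambda_ (k + m)] be the set of points of [U] that
    leave [U] at the next step of [T = F ^ k]. An orbit segment of length [N]
    that visits [U] but not [Q] is still in [U] at time [N], so avoiding [U] and
    avoiding [Q] up to time [N] differ by an event of measure at most [v m]
    ([pr_avoid_exit]). The measures [x_N] of the sets of points avoiding [Q] up to
    time [N] satisfy [x_N - x_(N+1) = mu (Q /\ T^-1 (avoid Q N))]. When this is
    close to [mu Q * x_N], the sequence [x_N] is close to [(1 - mu Q) ^ N]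
    ([geometric_perturbation]), and [(1 - mu Q) ^ w_n] tends to
    [expR (- (theta * tau))] since [w_n * v m --> tau] and [mu Q / v m --> theta].

    The near independence holds after a time gap [t] by the decay of
    correlations, applied to the set [A] of points of [U] that do not return to
    [U] at the times [1, ..., q_n] of [T] ([pr_escape_avoid]). It remains to
    bound the returns of [Q] to [U] at the times before the gap, and up to [q_n]
    as [Q `\` A] consists of points that return. This is [quick_returns]. A point
    of [Q] is outside [U] at every positive multiple [i <= m] of [k], because up
    to time [m] its orbit under [F] follows that under [G]. For [i > m], the
    inclusion of [Lambda_ m] in [Lambda_ p], with [p] a small fixed proportion of
    [i] (at most [m]), and the decay of correlations give
      [mu (Lambda_ m /\ F^-i (Lambda_ m)) <= v m * (v p + C * r ^ i * 3 * s ^ p)],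
    since the indicator of a union of [s ^ p] intervals has BV norm at most
    [3 * s ^ p]. The proportion is chosen so that [r ^ i * s ^ p] is exponentially
    small in [i]. The same inequality with [Lambda_ n] for the second hole, and
    [p] fixed with [v p] small, shows that [v] decays exponentially as soon as
    it tends to [0] ([Lambda_halving]). Hence the returns after time [m] contribute
    [o (v m)]. No distortion estimate on the branches is needed.

    If [v] does not tend to [0] through positive values, or if [tau = 0], then
    [w_n] is eventually [0] and [theta * tau = 0], so that both sides are [1]
    ([degenerate_limits]). *)

Set Implicit Arguments.
Unset Strict Implicit.
Unset Printing Implicit Defensive.

Import Order.TTheory GRing.Theory Num.Theory.
Import numFieldNormedType.Exports.

Local Open Scope classical_set_scope.
Local Open Scope ring_scope.

(** * Avoiding a set along the orbits of a measure-preserving map *)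

Section RealProbability.
Context d (X : measurableType d) (R : realType) (mu : probability X R).
Implicit Types A B : set X.

Lemma pr_ge0 A : 0 <= fine (mu A).
Proof. by rewrite fine_ge0. Qed.

Lemma pr_fin A : measurable A -> mu A = (fine (mu A))%:E.
Proof. by move=> mA; rewrite fineK ?fin_num_measure. Qed.

Lemma pr_le1 A : measurable A -> fine (mu A) <= 1.
Proof. by move=> mA; rewrite -lee_fin -pr_fin ?probability_le1. Qed.

Lemma pr_le A B : measurable A -> measurable B -> A `<=` B ->
  fine (mu A) <= fine (mu B).
Proof.
by move=> mA mB AB; rewrite -lee_fin -!pr_fin// le_measure// inE.
Qed.

Lemma prDI A B : measurable A -> measurable B ->
  fine (mu A) = fine (mu (A `\` B)) + fine (mu (A `&` B)).
Proof.
move=> mA mB; rewrite (measureDI mu mA mB) fineD//.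
- by rewrite fin_num_measure//; exact: measurableD.
- by rewrite fin_num_measure//; exact: measurableI.
Qed.

Lemma pr_union_bound A (E : nat -> set X) n :
    measurable A -> (forall j, measurable (E j)) ->
    (forall x, A x -> exists2 j, (j < n)%N & E j x) ->
  fine (mu A) <= \sum_(j < n) fine (mu (E j)).
Proof.
move=> mA mE AE; rewrite -lee_fin -pr_fin// -sumEFin.
under eq_bigr do rewrite -pr_fin//.
apply: content_subadditive => // x /AE[j jn Ejx].
by rewrite -bigcup_mkord; exists j.
Qed.

End RealProbability.

Lemma geometric_perturbation (R : realFieldType) (x : nat -> R) (a e : R) N :
    0 <= a <= 1 -> x 0%N = 1 ->
    (forall n, `|x n - x n.+1 - a * x n| <= e) ->
  `|x N - (1 - a) ^+ N| <= N%:R * e.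
Proof.
move=> /andP[a0 a1] x0 h; elim: N => [|N ih].
  by rewrite x0 expr0 subrr normr0 mul0r.
have -> : x N.+1 - (1 - a) ^+ N.+1 =
   (1 - a) * (x N - (1 - a) ^+ N) - (x N - x N.+1 - a * x N).
  by rewrite exprS; ring.
apply: le_trans (ler_normB _ _) _.
have -> : N.+1%:R * e = N%:R * e + e by rewrite -natr1 mulrDl mul1r.
apply: lerD => //; apply: le_trans ih; rewrite normrM ler_piMl//.
by rewrite ger0_norm; lra.
Qed.

Section Avoidance.
Context d (X : measurableType d) (R : realType) (mu : probability X R).
Variable T : X -> X.
Hypothesis mT : measurable_fun setT T.
Hypothesis invT : forall A, measurable A -> mu (T @^-1` A) = mu A.
Implicit Types (A : set X) (N : nat).

Lemma measurable_preimage_iter n A :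
  measurable A -> measurable (iter n T @^-1` A).
Proof.
move=> mA; elim: n => [//|n ih].
have -> : iter n.+1 T @^-1` A = T @^-1` (iter n T @^-1` A).
  by apply/seteqP; split=> x /=; rewrite -iterS iterSr.
by rewrite -[_ @^-1` _]setTI; exact: mT.
Qed.

Lemma measurable_fun_iter n : measurable_fun setT (iter n T).
Proof. by move=> _ A mA; rewrite setTI; exact: measurable_preimage_iter. Qed.

Lemma measure_preimage_iter n A : measurable A -> mu (iter n T @^-1` A) = mu A.
Proof.
move=> mA; elim: n => [//|n ih].
have -> : iter n.+1 T @^-1` A = T @^-1` (iter n T @^-1` A).
  by apply/seteqP; split=> x /=; rewrite -iterS iterSr.
by rewrite invT//; exact: measurable_preimage_iter.
Qed.

(** The points whose orbit does not meet [A] at the times [0, ..., N - 1]. *)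
Definition avoid A N : set X :=
  [set x | forall j, (j < N)%N -> ~ A (iter j T x)].

Lemma avoid0 A : avoid A 0 = setT.
Proof. by apply/seteqP; split. Qed.

Lemma avoidS A N : avoid A N.+1 = T @^-1` (avoid A N) `\` A.
Proof.
apply/seteqP; split=> x /=.
  move=> h; split; last exact: (h 0%N).
  by move=> j jN; rewrite -iterSr; apply: h.
by move=> [h Ax] [|j] jN //; rewrite iterSr; apply: h.
Qed.

Lemma measurable_avoid A N : measurable A -> measurable (avoid A N).
Proof.
move=> mA; elim: N => [|N ih]; first by rewrite avoid0.
rewrite avoidS; apply: measurableD => //.
exact: (measurable_preimage_iter 1).
Qed.

Lemma avoid_le A N N' : (N <= N')%N -> avoid A N' `<=` avoid A N.
Proof. by move=> NN' x h j jN; apply: h; exact: leq_trans NN'. Qed.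

Lemma pr_avoidS A N : measurable A ->
  fine (mu (avoid A N.+1)) =
  fine (mu (avoid A N)) - fine (mu (A `&` T @^-1` avoid A N)).
Proof.
move=> mA; have mN := measurable_avoid N mA.
have mTN := measurable_preimage_iter 1 mN.
rewrite avoidS -(measure_preimage_iter 1 mN) (prDI _ mTN mA) setIC.
by rewrite /= addrK.
Qed.

Lemma pr_avoidD A N p : measurable A ->
  fine (mu (avoid A N)) - p%:R * fine (mu A) <= fine (mu (avoid A (N + p))).
Proof.
move=> mA; elim: p => [|p ih]; first by rewrite addn0 mul0r subr0.
rewrite addnS pr_avoidS// -[p.+1]addn1 natrD mulrDl mul1r opprD addrA.
apply: lerB => //; apply: pr_le => //.
apply: measurableI => //.
by apply: (measurable_preimage_iter 1); exact: measurable_avoid.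
Qed.

(** Being in [Q] at time [0] is nearly independent of avoiding [Q] from time [1]
    on. The error adds up the returns to [Q] before time [t], the loss of the
    first [t] times, the mixing defect [delta] of [A] after the gap [t], and the
    measure of [Q] outside [A]. *)
Lemma pr_escape_avoid (Q A : set X) (t : nat) (delta : R) N :
    measurable Q -> measurable A -> A `<=` Q -> (0 < t)%N ->
    (forall V, measurable V ->
      `|fine (mu (A `&` iter t T @^-1` V)) - fine (mu A) * fine (mu V)|
        <= delta) ->
  `|fine (mu (Q `&` T @^-1` avoid Q N)) - fine (mu Q) * fine (mu (avoid Q N))|
   <= \sum_(j < t.-1) fine (mu (Q `&` iter j.+1 T @^-1` Q))
      + t%:R * fine (mu Q) ^+ 2 + delta + fine (mu (Q `\` A)).
Proof.
move=> mQ mA AQ t0 hdelta.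
have mW := fun N => measurable_avoid N mQ.
set V := avoid Q (N.+1 - t); have mV : measurable V by exact: mW.
have mTV := measurable_preimage_iter t mV.
have mTW := measurable_preimage_iter 1 (mW N).
have mQV : measurable (Q `&` iter t T @^-1` V) by exact: measurableI.
have mQW : measurable (Q `&` T @^-1` avoid Q N) by exact: measurableI.
have mD : measurable (Q `\` A) by exact: measurableD.
(* replacing the times 1, ..., N by the times t, ..., N *)
have WV : Q `&` T @^-1` avoid Q N `<=` Q `&` iter t T @^-1` V.
  move=> x [Qx h]; split => // j jN.
  rewrite -iterD -[(j + t)%N]prednK ?addn_gt0 ?t0 ?orbT//.
  by rewrite iterSr; apply: h; lia.
have short : fine (mu ((Q `&` iter t T @^-1` V) `\` (Q `&` T @^-1` avoid Q N)))
    <= \sum_(j < t.-1) fine (mu (Q `&` iter j.+1 T @^-1` Q)).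
  apply: (@pr_union_bound _ _ _ mu _ (fun j => Q `&` iter j.+1 T @^-1` Q)).
  - exact: measurableD.
  - by move=> j; apply: measurableI => //; exact: measurable_preimage_iter.
  - move=> x [[Qx hV] hW]; apply: contrapT => nex.
    apply: hW; split => // j jN; rewrite -iterSr => QT.
    have [jt|jt] := ltnP j t.-1; first by apply: nex; exists j.
    apply: (hV (j.+1 - t)%N); first by lia.
    by rewrite -iterD subnK//; lia.
have eW := prDI mu mQV mQW; rewrite (setIidr WV) in eW.
have short0 := pr_ge0 mu ((Q `&` iter t T @^-1` V) `\` (Q `&` T @^-1` avoid Q N)).
(* replacing Q by A *)
have eQ := prDI mu mQ mA; rewrite (setIidr AQ) in eQ.
have mAV : measurable (A `&` iter t T @^-1` V) by exact: measurableI.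
have eQV := prDI mu mQV mAV.
have AV : A `&` iter t T @^-1` V `<=` Q `&` iter t T @^-1` V by exact: setSI.
rewrite (setIidr AV) in eQV.
have leD : fine (mu ((Q `&` iter t T @^-1` V) `\` (A `&` iter t T @^-1` V)))
    <= fine (mu (Q `\` A)).
  apply: pr_le => //; first exact: measurableD.
  by move=> x [[Qx Vx] nA]; split => // Ax; apply: nA.
have D0 := pr_ge0 mu ((Q `&` iter t T @^-1` V) `\` (A `&` iter t T @^-1` V)).
have D1 := pr_ge0 mu (Q `\` A).
have V0 := pr_ge0 mu V; have V1 := pr_le1 mu mV.
have Q0 := pr_ge0 mu Q.
have VW : fine (mu V) - t%:R * fine (mu Q) <= fine (mu (avoid Q N)).
  apply: le_trans (pr_avoidD (N.+1 - t) t mQ) _.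
  by apply: pr_le => //; apply: avoid_le; lia.
have WV' : fine (mu (avoid Q N)) <= fine (mu V).
  by apply: pr_le => //; apply: avoid_le; lia.
have := hdelta V mV; rewrite !ler_norml => /andP[d1 d2].
set S := \sum_(j < _) _ in short *.
have p1 : fine (mu Q) * fine (mu (avoid Q N)) <= fine (mu Q) * fine (mu V).
  exact: ler_wpM2l.
have p2 := ler_wpM2l Q0 VW.
have p3 : fine (mu (Q `\` A)) * fine (mu V) <= fine (mu (Q `\` A)).
  by rewrite -[leRHS]mulr1; exact: ler_wpM2l.
have p4 : 0 <= fine (mu (Q `\` A)) * fine (mu V) by exact: mulr_ge0.
have p5 : 0 <= t%:R * fine (mu Q) ^+ 2 by rewrite mulr_ge0// exprn_ge0.
have eQV' : fine (mu Q) * fine (mu V) =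
    fine (mu (Q `\` A)) * fine (mu V) + fine (mu A) * fine (mu V).
  by rewrite eQ mulrDl.
have p6 : fine (mu Q) * (fine (mu V) - t%:R * fine (mu Q)) =
  fine (mu Q) * fine (mu V) - t%:R * fine (mu Q) ^+ 2 by ring.
rewrite p6 in p2.
by apply/andP; split; lra.
Qed.

(** If the points of [U] that are not in [Q] stay in [U] at the next time, then
    avoiding [U] amounts to avoiding [Q], except on an event contained in
    [iter N T @^-1` U]. *)
Lemma pr_avoid_exit (U Q : set X) N :
    measurable U -> measurable Q -> Q `<=` U -> U `\` Q `<=` T @^-1` U ->
  `|fine (mu (avoid U N)) - fine (mu (avoid Q N))| <= fine (mu U).
Proof.
move=> mU mQ QU UT.
have mWU := measurable_avoid N mU; have mWQ := measurable_avoid N mQ.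
have sub : avoid U N `<=` avoid Q N by move=> x h j jN /QU; exact: h.
have := prDI mu mWQ mWU; rewrite (setIidr sub) => ->.
rewrite opprD addrA addrAC subrr add0r normrN ger0_norm ?pr_ge0//.
rewrite -(measure_preimage_iter N mU); apply: pr_le.
- exact: measurableD.
- exact: measurable_preimage_iter.
move=> x [hQ]; apply: contra_notP => nU j jN Uj; apply: nU.
suff: forall i, (j <= i <= N)%N -> U (iter i T x) by apply; rewrite ltnW/=.
elim=> [|i ih] /andP[ji iN]; first by move: ji Uj; rewrite leqn0 => /eqP->.
move: ji; rewrite leq_eqVlt => /predU1P[<-//|ji].
by apply: UT; split; [apply: ih; rewrite -ltnS ji ltnW|exact: hQ].
Qed.

Lemma pr_avoid_approx (U Q A : set X) (t : nat) (delta : R) N :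
    measurable U -> measurable Q -> measurable A -> A `<=` Q -> Q `<=` U ->
    U `\` Q `<=` T @^-1` U -> (0 < t)%N ->
    (forall V, measurable V ->
      `|fine (mu (A `&` iter t T @^-1` V)) - fine (mu A) * fine (mu V)|
        <= delta) ->
  `|fine (mu (avoid U N)) - (1 - fine (mu Q)) ^+ N|
   <= fine (mu U)
      + N%:R * (\sum_(j < t.-1) fine (mu (Q `&` iter j.+1 T @^-1` Q))
                + t%:R * fine (mu Q) ^+ 2 + delta + fine (mu (Q `\` A))).
Proof.
move=> mU mQ mA AQ QU UT t0 hd.
rewrite -[X in `|X|](subrKA (fine (mu (avoid Q N)))).
apply: le_trans (ler_normD _ _) _; apply: lerD; first exact: pr_avoid_exit.
apply: (geometric_perturbation (x := fun n => fine (mu (avoid Q n)))).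
- by rewrite pr_ge0 pr_le1.
- by rewrite avoid0 probability_setT.
move=> n; rewrite pr_avoidS// opprB addrCA subrr addr0.
exact: (pr_escape_avoid (A := A)).
Qed.

End Avoidance.

(** * Variation of indicators of unions of intervals *)

Section IndicatorVariation.
Context {R : realType}.
Implicit Types A B : set R.

(** Both the set of points to the right of some point of [A] and its subset
    of points outside [A] are up-sets, so [\1_A] is the difference of two
    nondecreasing functions with values in [0, 1]. *)
Lemma total_variation_interval A : is_interval A ->
  (total_variation 0 1 (\1_A : R -> R) <= 2%:E)%E.
Proof.
move=> iA; pose U := [set x | exists2 a, A a & a <= x].
have TVup (V : set R) : (forall x y, V x -> x <= y -> V y) ->
    (total_variation 0 1 (\1_V : R -> R) <= 1%:E)%E.
  move=> upV; rewrite nondecreasing_total_variation//; last first.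
    move=> x y _ _ xy; rewrite !indicE ler_nat.
    case: (boolP (x \in V)) => // /set_mem Vx.
    by rewrite (mem_set (upV _ _ Vx xy)).
  rewrite lee_fin !indicE; case: (1 \in V); case: (0 \in V) => /=; lra.
have -> : (\1_A : R -> R) = \1_U \+ (\- \1_(U `\` A)).
  apply/funext => x /=; rewrite !indicE.
  have [xA|xA] := boolP (x \in A).
    have -> : x \in U by apply/mem_set; exists x => //; exact: set_mem.
    rewrite (_ : x \in U `\` A = false) ?subr0//.
    by apply/negbTE/negP => /set_mem[_]; apply; exact: set_mem.
  have nA : ~ A x by move=> /mem_set; apply/negP.
  have [xU|xU] := boolP (x \in U).
    by rewrite (mem_set (conj (set_mem xU) nA : (U `\` A) x)) subrr.
  rewrite (_ : x \in U `\` A = false) ?subr0//.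
  by apply/negbTE/negP => /set_mem[/mem_set]; rewrite (negbTE xU).
apply: le_trans (total_variation_le _ _ _) _ => //.
rewrite total_variationN (_ : 2%:E = 1%:E + 1%:E)%E; last first.
  by rewrite -EFinD.
apply: leeD; apply: TVup => x y.
  by move=> [a Aa ax] xy; exists a => //; exact: le_trans xy.
move=> [[a Aa ax] nAx] xy; split; first by exists a => //; exact: le_trans xy.
by move=> Ay; apply: nAx; apply: (iA _ _ Aa Ay); rewrite ax.
Qed.

Lemma total_variation_setU A B :
  (total_variation 0 1 (\1_(A `|` B) : R -> R) <=
   total_variation 0 1 (\1_A : R -> R) + total_variation 0 1 (\1_B : R -> R))%E.
Proof.
apply: ge_ereal_sup => _ [_ [l ll <-] <-].
have le_tv C : ((variation 0 1 (\1_C : R -> R) l)%:E <=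
    total_variation 0 1 (\1_C : R -> R))%E.
  apply: ereal_sup_ubound; exists (variation 0 1 (\1_C : R -> R) l) => //.
  by exists l.
apply: le_trans (leeD (le_tv A) (le_tv B)).
rewrite -EFinD lee_fin /variation -big_split/=; apply: ler_sum => i _ /=.
rewrite !indicE !in_setU.
by do 4 case: (_ \in _) => /=; rewrite ?subrr ?subr0 ?sub0r ?normrN ?normr0 ?normr1; lra.
Qed.

Lemma total_variation_union_intervals (I : finType) (g : I -> set R) :
  (forall i, is_interval (g i)) ->
  (total_variation 0 1 (\1_(\bigcup_i g i) : R -> R) <= (2 * #|I|%:R)%:E)%E.
Proof.
move=> ig; have -> : \bigcup_i g i = \big[setU/set0]_(i <- index_enum I) g i.
  by rewrite -bigcup_seq; apply: eq_bigcupl; split=> i //= _; rewrite mem_index_enum.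
have -> : 2 * #|I|%:R = \sum_(i <- index_enum I) 2 :> R.
  by rewrite sumr_const mulr_natr.
rewrite -sumEFin.
apply: (big_ind2 (fun (A : set R) e => (total_variation 0 1 (\1_A : R -> R) <= e)%E)).
- by rewrite indic0 nondecreasing_total_variation// subrr.
- move=> A e B e' Ae Be'; apply: le_trans (total_variation_setU _ _) _.
  exact: leeD.
- by move=> i _; exact: total_variation_interval.
Qed.

Lemma BVnorm_indic_ge0 A : (0 <= BVnorm (\1_A : R -> R))%E.
Proof.
apply: adde_ge0; last by rewrite total_variation_ge0.
apply: le_ereal_sup_tmp; exists (`|\1_A (0 : R)| : R)%:E; last by rewrite lee_fin.
by exists 0 => //=; rewrite in_itv/= lexx ler01.
Qed.

Lemma BVnorm_indic_le A (e : R) :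
  (total_variation 0 1 (\1_A : R -> R) <= e%:E)%E ->
  (BVnorm (\1_A : R -> R) <= (1 + e)%:E)%E.
Proof.
move=> Ae; rewrite EFinD; apply: leeD => //.
apply: ge_ereal_sup => _ [x _ <-]; rewrite lee_fin indicE.
by case: (_ \in _); rewrite ?normr1 ?normr0.
Qed.

End IndicatorVariation.

(** * Geometry of the holes and measurability of the map *)

Section Dynamics.
Context {R : realType} {s : nat}.
Variables (f : 'I_s -> R -> R) (F : R -> R).
Hypothesis cf : contracting_family f.
Hypothesis eF : gap_extension f F.
Implicit Types (x y : R) (n m : nat).

Let fI01 i x : I01 x -> I01 (f i x).
Proof. by case: cf => h _ _ _; exact: h. Qed.

Let f_inj i x y : I01 x -> I01 y -> f i x = f i y -> x = y.
Proof.
case: cf => _ h _ _ Ix Iy fxy; have [_ [g [_ gf]]] := h i.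
by rewrite -(gf x Ix) -(gf y Iy) fxy.
Qed.

Let f_cont i : {within I01, continuous (f i)}.
Proof.
case: cf => _ _ h _; have [l l1 fl] := h i.
apply/subspace_continuousP => x Ix.
apply/cvgrPdist_le => e e0; rewrite near_withinE; near=> y => Iy.
apply: le_trans (fl _ _ Ix Iy) _.
apply: (@le_trans _ _ `|x - y|); last first.
  by near: y; apply: cvgr_dist_le => //; exact: cvg_id.
by rewrite -[leRHS]mul1r ler_wpM2r// ltW.
Unshelve. all: by end_near. Qed.

Lemma image_interval i (A : set R) : A `<=` I01 -> is_interval A ->
  is_interval (f i @` A).
Proof.
move=> AI iA; apply/connected_intervalP; apply: connected_continuous_connected.
  exact/connected_intervalP.
exact: (continuous_subspaceW AI (@f_cont i)).
Qed.

Let J_uniq i j x : J f i x -> J f j x -> i = j.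
Proof.
move=> Ji Jj; apply/eqP; apply: contrapT => /negP ij.
by case: cf => _ _ _ /(_ _ _ ij); move/seteqP => [+ _] => /(_ x); apply.
Qed.

Let I01_2 : ~ I01 (2 : R).
Proof. by rewrite /= in_itv/=; lra. Qed.

Lemma G_branch i y : I01 y -> G f (f i y) = y.
Proof.
move=> Iy; rewrite /G; case: pickP => [j /set_mem Jj|/(_ i)]; last first.
  by rewrite mem_set//; exists y.
have Ji : J f i (f i y) by exists y.
rewrite -(J_uniq Ji Jj); apply: pinvKV; last exact/mem_set.
by move=> a b /set_mem Ia /set_mem Ib; exact: f_inj.
Qed.

(** [G] takes the value [2] off the images of the branches. *)
Lemma G_I01 x : I01 (G f x) -> exists i, f i (G f x) = x.
Proof.
case: (pickP (fun i => x \in J f i)) => [i /set_mem[y Iy <-] _|nJ].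
  by exists i; rewrite G_branch.
by rewrite /G; case: pickP => [i|_ /I01_2//]; rewrite nJ.
Qed.

Lemma Lambda_sub_I01 n : Lambda_ f n `<=` I01.
Proof.
elim: n => [//|n ih] x /= /ih Ix; have [i <-] := G_I01 Ix; exact: fI01.
Qed.

Lemma Lambda_nested n m : (n <= m)%N -> Lambda_ f m `<=` Lambda_ f n.
Proof.
suff H p : Lambda_ f p.+1 `<=` Lambda_ f p.
  elim: m => [|m ih]; first by rewrite leqn0 => /eqP->.
  rewrite leq_eqVlt => /predU1P[->//|nm]; exact: subset_trans (H m) (ih nm).
elim: p => [|p ih]; first exact: (@Lambda_sub_I01 1).
by move=> x /ih.
Qed.

Lemma Lambda_iterG m n x : Lambda_ f (m + n) x <-> Lambda_ f n (iter m (G f) x).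
Proof. by elim: m x => [//|m ih] x; rewrite iterSr -ih. Qed.

Lemma LambdaP x : Lambda f x <-> forall n, Lambda_ f n x.
Proof.
split=> [[Ix h] n|h].
  rewrite -[n]addn0 Lambda_iterG; case: n => [//|n]; exact: h.
split; first exact: (h 0%N).
by move=> n _; have := h n; rewrite -[X in Lambda_ f X x]addn0 Lambda_iterG.
Qed.

(** Both sides are false outside [0, 1], where [phi] takes the value [0]. *)
Lemma lt_phi n x : (n%:R%:E < phi f x)%E <-> Lambda_ f n x.
Proof.
rewrite /phi; case: (boolP (x \in Lambda f)) => [/set_mem/LambdaP h|nL].
  by split=> // _; rewrite ltry.
have {}nL : ~ Lambda f x by move=> /mem_set; apply/negP.
rewrite lte_fin ltr_nat; case: xgetP => [l _ [l0 [Ll nLl]]|none].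
  split=> [nl|Ln]; first by apply: Lambda_nested Ll; rewrite -ltnS prednK.
  by rewrite ltnNge; apply/negP => ln; apply: nLl; exact: Lambda_nested Ln.
split=> // Ln; exfalso.
have /existsNP exN : ~ forall n, Lambda_ f n x by move=> h; exact/nL/LambdaP.
have {}exN : exists m, `[< ~ Lambda_ f m x >].
  by have [m] := exN; exists m; exact/asboolP.
case: (ex_minnP exN) => m /asboolP nm min.
apply: (none m); case: m nm min => [nm _|m nm min].
  by exfalso; apply/nm/Lambda_sub_I01; exact: Ln.
split=> //; split => //=; apply: contrapT => nLm.
by have := min m (asboolT nLm); rewrite ltnn.
Qed.

Lemma F_G x : Lambda_ f 1 x -> F x = G f x.
Proof.
move=> /= Ix; have [i fx] := G_I01 Ix; apply: (eF.1 i).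
by rewrite -fx; exists (G f x).
Qed.

Lemma iterF_iterG n i x : Lambda_ f n x -> (i <= n)%N ->
  iter i F x = iter i (G f) x.
Proof.
move=> Ln; elim: i => [//|i ih] lin; rewrite !iterS ih ?F_G//; last exact: ltnW.
have /Lambda_iterG : Lambda_ f (i + 1) x by apply: Lambda_nested Ln; rewrite addn1.
by [].
Qed.

Lemma gapsP x : I01 x -> ~ gaps f x -> Lambda_ f 1 x.
Proof.
move=> Ix ng; have [i _ [y Iy <-]] : (\bigcup_i J f i) x.
  by apply: contrapT => nJ; exact: ng.
by rewrite /= G_branch.
Qed.

Lemma F_I01 x : I01 x -> I01 (F x).
Proof.
move=> Ix; have [gx|/(gapsP Ix) Lx] := pselect (gaps f x).
  have [_ [_ h]] := eF.2 x gx; apply: h; exists x => //.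
  exact: connected_component_refl.
by rewrite F_G//; exact: Lx.
Qed.

(** The image of [0, 1] under the composition of branches along a word. *)
Definition cylinder (w : seq 'I_s) : set R := foldr (fun i A => f i @` A) I01 w.

Lemma cylinder_sub w : cylinder w `<=` I01.
Proof. by elim: w => [//|i w ih] _ /= [x /ih Ix <-]; exact: fI01. Qed.

Lemma cylinder_interval w : is_interval (cylinder w).
Proof.
elim: w => [|i w ih]; first exact: interval_is_interval.
by apply: image_interval => //; exact: cylinder_sub.
Qed.

Lemma Lambda_cylinders n :
  Lambda_ f n = \bigcup_(w : n.-tuple 'I_s) cylinder w.
Proof.
apply/seteqP; split=> x.
  elim: n x => [|n ih] x Lx; first by exists [tuple].
  have Ix := Lambda_sub_I01 (Lx : Lambda_ f n (G f x)).
  have [i fx] := G_I01 Ix; have [w _ wG] := ih _ Lx.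
  by exists [tuple of i :: w] => //=; exists (G f x).
elim: n x => [|n ih] x [w _]; first by rewrite tuple0.
case/tupleP: w => i w /= [y yw <-]; rewrite G_branch; first by apply: ih; exists w.
exact: cylinder_sub yw.
Qed.

Lemma measurable_Lambda n :
  measurable (Lambda_ f n : set (measurableTypeR R)).
Proof.
rewrite Lambda_cylinders; apply: fin_bigcup_measurable => [|w _].
  exact: finite_finset.
by apply: is_interval_measurable; exact: cylinder_interval.
Qed.

Lemma total_variation_Lambda n :
  (total_variation 0 1 (\1_(Lambda_ f n) : R -> R) <= (2 * s%:R ^+ n)%:E)%E.
Proof.
rewrite Lambda_cylinders.
have := total_variation_union_intervals (g := fun w : n.-tuple 'I_s => cylinder w)
   (fun w => @cylinder_interval w).
by rewrite card_tuple card_ord natrX.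
Qed.

Lemma BVnorm_Lambda n : (0 < s)%N ->
  (BVnorm (\1_(Lambda_ f n) : R -> R) <= (3 * s%:R ^+ n)%:E)%E.
Proof.
move=> s0; apply: le_trans (BVnorm_indic_le (total_variation_Lambda n)) _.
have s1 : 1 <= s%:R ^+ n :> R by rewrite exprn_ege1// ler1n.
by rewrite lee_fin; lra.
Qed.

Lemma measurable_J i : measurable (J f i : set (measurableTypeR R)).
Proof.
by apply: is_interval_measurable; exact: (@cylinder_interval [:: i]).
Qed.

Let measurable_bigJ :
  measurable (\bigcup_i J f i : set (measurableTypeR R)).
Proof.
apply: fin_bigcup_measurable => [|i _]; first exact: finite_finset.
exact: measurable_J.
Qed.

Let closed_J i : closed (J f i).
Proof.
apply: compact_closed; first exact: Rhausdorff.
by apply: continuous_compact => //; exact: segment_compact.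
Qed.

(** Each point of the gaps is interior, relatively to [0, 1], to its component,
    on which [F] is affine. *)
Lemma F_continuous_gaps : {within gaps f, continuous F}.
Proof.
apply/subspace_continuousP => x gx.
have [[a [b Fab]] _] := eF.2 x gx.
have oJ : open (~` \bigcup_i J f i).
  apply: closed_openC; apply: closed_bigcup => [|i _].
    exact: finite_finset.
  exact: closed_J.
have /nbhs_ballP[e /= e0 be] : nbhs x (~` \bigcup_i J f i).
  by apply: open_nbhs_nbhs; split=> //; exact: gx.2.
have comp y : ball x e y -> I01 y -> connected_component (gaps f) x y.
  move=> bxy Iy; apply: (connected_component_max (B := ball x e `&` I01)) => //.
  - by split; [exact: ballxx|exact: gx.1].
  - by move=> z [/be nz Iz]; split.
  - apply/connected_intervalP => u v [bu Iu] [bv Iv] z /andP[uz zv]; split.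
      move: bu bv; rewrite /ball/= !ltr_norml => /andP[? ?] /andP[? ?].
      by apply/andP; split; lra.
    move: Iu Iv; rewrite /= !in_itv/= => /andP[? ?] /andP[? ?].
    by apply/andP; split; lra.
have aff : a * y + b @[y --> within (gaps f) (nbhs x)] --> a * x + b.
  apply: cvg_within_filter; apply: cvgD; last exact: cvg_cst.
  by apply: cvgM; [exact: cvg_cst|exact: cvg_id].
rewrite -(Fab x) in aff; last exact: connected_component_refl.
apply: cvg_trans aff; apply: near_eq_cvg; rewrite near_withinE.
near=> y => gy; apply: esym; apply: Fab; apply: comp; last exact: gy.1.
by near: y; exact: nbhsx_ballx.
Unshelve. all: by end_near. Qed.

Lemma measurable_F :
  measurable_fun (I01 : set (measurableTypeR R))
    (F : measurableTypeR R -> measurableTypeR R).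
Proof.
have -> : I01 = gaps f `|` \bigcup_i J f i.
  apply/seteqP; split=> x.
    move=> Ix; have [Jx|nJ] := pselect ((\bigcup_i J f i) x); first by right.
    by left; split.
  by case=> [[]//|[i _ [y Iy <-]]]; exact: fI01.
have mgaps : measurable (gaps f : set (measurableTypeR R)).
  by apply: measurableD => //; exact: measurable_itv.
apply/measurable_funU => //; split.
  by apply: subspace_continuous_measurable_fun => //; exact: F_continuous_gaps.
move=> mJ.
apply: (measurability _ (RGenCInfty.measurableE R)) => //.
(* on J i the preimage of a ray is the image by f i of an interval *)
move=> _ [_ [z ->] <-].
have -> : \bigcup_i J f i `&` F @^-1` `[z, +oo[ =
    \bigcup_i f i @` (I01 `&` `[z, +oo[).
  apply/seteqP; split=> x.
    move=> [[i _ [y Iy fy]]] /=; rewrite (eF.1 i) -?fy; last by exists y.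
    by rewrite G_branch// => zy; exists i => //; exists y.
  move=> [i _ [y [Iy zy] <-]]; split; first by exists i => //; exists y.
  by rewrite /= (eF.1 i) ?G_branch//; exists y.
apply: fin_bigcup_measurable => [|i _]; first exact: finite_finset.
apply: is_interval_measurable.
apply: image_interval => [x []//|a b [Ia za] [Ib zb] c abc]; split.
  exact: (interval_is_interval Ia Ib abc).
exact: (interval_is_interval za zb abc).
Qed.

End Dynamics.

(** * The invariant measure and the decay of correlations *)

Section Extension.
Context {R : realType}.
Variables (mu : probability (measurableTypeR R) R) (F : R -> R).
Hypothesis mu1 : mu I01 = 1%E.
Hypothesis F01 : forall x, I01 x -> I01 (F x).
Hypothesis mF : measurable_fun (I01 : set (measurableTypeR R))
  (F : measurableTypeR R -> measurableTypeR R).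
Hypothesis invF : invariant_measure mu F.

(** [F] extended by [0] outside [0, 1], a measurable map of the line into
    itself that preserves [mu]. *)
Definition extend0 : measurableTypeR R -> measurableTypeR R := F \_ I01.

Lemma iter_extend0 n x : I01 x -> iter n extend0 x = iter n F x.
Proof.
move=> Ix; have In m : I01 (iter m F x) by elim: m => //= m; exact: F01.
by elim: n => [//|n ih]; rewrite !iterS ih /extend0 patchT//; exact/mem_set.
Qed.

Let mI01 : measurable (I01 : set (measurableTypeR R)).
Proof. exact: measurable_itv. Qed.

Lemma measurable_extend0 : measurable_fun setT extend0.
Proof. exact/(measurable_restrictT F mI01). Qed.

Lemma mu_setI01 (A : set (measurableTypeR R)) :
  measurable A -> mu (A `&` I01) = mu A.
Proof.
move=> mA; rewrite [RHS](measureDI mu mA mI01).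
rewrite [X in (X + _)%E](_ : _ = 0%E) ?add0e//.
apply/eqP; rewrite eq_le measure_ge0 andbT.
have <- : mu (~` I01) = 0%E by rewrite probability_setC// mu1 subee.
apply: le_measure; rewrite ?inE; [exact: measurableD|exact: measurableC|].
by move=> x [].
Qed.

Lemma invariant_extend0 (A : set (measurableTypeR R)) :
  measurable A -> mu (extend0 @^-1` A) = mu A.
Proof.
move=> mA; rewrite -[RHS](invF mA) -mu_setI01.
  congr (mu _); apply/seteqP; split=> x /= [].
    by move=> + Ix; rewrite /extend0 patchT//; exact/mem_set.
  by move=> Ix; rewrite /extend0 patchT//; exact/mem_set.
by rewrite -[_ @^-1` _]setTI; exact: measurable_extend0.
Qed.

(** Decay of correlations for events. *)
Lemma decay_indic (r : R) : exp_decay mu F r ->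
  exists2 C : R, 0 < C & forall (A V : set (measurableTypeR R)) (b : R) n,
    measurable A -> measurable V -> (0 < n)%N ->
    (BVnorm (\1_A : R -> R) <= b%:E)%E ->
    `|fine (mu (A `&` iter n extend0 @^-1` V)) - fine (mu A) * fine (mu V)|
      <= C * r ^+ n * b * fine (mu V).
Proof.
move=> [C C0 [/andP[r0 r1] h]]; exists C => // A V b n mA mV n0 Ab.
have bvA : BV (\1_A : R -> R) by apply: le_lt_trans Ab (ltry _).
have iV : mu.-integrable I01 (EFin \o (\1_V : measurableTypeR R -> R)).
  exact: integrableS (integrable_indic mu mV).
have mTV := measurable_preimage_iter measurable_extend0 n mV.
have mAV : measurable (A `&` iter n extend0 @^-1` V) by exact: measurableI.
have eI B : measurable B -> \int[mu]_(x in I01) (\1_B x : R) = fine (mu B).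
  by move=> mB; rewrite /Rintegral integral_indic//; congr fine; exact: mu_setI01.
have := h _ _ _ bvA iV n0; rewrite !eI//.
have -> : \int[mu]_(x in I01) (\1_A x * \1_V (iter n F x)) =
    fine (mu (A `&` iter n extend0 @^-1` V)).
  rewrite -eI//; apply: eq_Rintegral => x /set_mem Ix.
  by rewrite -[iter n F x]iter_extend0// !indicE -natrM mulnb in_setI.
have -> : (\int[mu]_(x in I01) `|\1_V x|%:E = (fine (mu V))%:E)%E.
  rewrite -pr_fin// -[RHS]mu_setI01//.
  transitivity (\int[mu]_(x in I01) (\1_V x)%:E)%E; last exact: integral_indic.
  by apply: eq_integral => x _; rewrite ger0_norm.
move=> hle; rewrite -lee_fin; apply: le_trans hle _.
rewrite [leRHS]EFinM lee_wpmul2r ?lee_fin ?pr_ge0//.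
rewrite [leRHS]EFinM lee_wpmul2l// lee_fin.
by rewrite mulr_ge0 ?exprn_ge0 ?ltW.
Qed.

End Extension.

(** * Exponential decay of the holes and quick returns *)

(** The bound is split into two equal factors for later use: one of them will be
    summed, and the other one will be small. *)
Lemma halving_geometric (R : realFieldType) d : (0 < d)%N ->
  exists K rho : R, [/\ 0 < K, 0 < rho < 1 &
    forall n, 2^-1 ^+ (n %/ d) <= K * (rho ^+ n * rho ^+ n)].
Proof.
move=> d0; have d1 : (1 : R) <= d%:R by rewrite ler1n.
pose a : R := (4 * d%:R)^-1; have a0 : 0 < a by rewrite invr_gt0; lra.
have ad : a * d%:R = 4^-1.
  by rewrite /a invfM -mulrA mulVf ?mulr1// gt_eqF//; lra.
have a4 : a <= 4^-1 by rewrite -ad ler_pMr.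
(* Bernoulli's inequality *)
have B m : 1 - m%:R * a <= (1 - a) ^+ m.
  elim: m => [|m ih]; first by rewrite expr0 mul0r subr0.
  rewrite exprS -natr1; apply: le_trans (ler_wpM2l _ ih); last by lra.
  have : 0 <= m%:R * a * a by rewrite !mulr_ge0// ltW.
  by lra.
exists 2, (1 - a); split => //; first by lra.
move=> n; have e2 : 2^-1 <= (1 - a) ^+ (d + d).
  by apply: le_trans (B _); rewrite natrD mulrDl mulrC ad; lra.
have r01 : 0 <= 1 - a <= 1 by lra.
rewrite -exprD {2 3}(divn_eq n d).
set q := (n %/ d)%N.
have -> : 2^-1 ^+ q = 2 * 2^-1 ^+ q.+1 :> R by rewrite exprS mulrA divff ?mul1r.
rewrite ler_pM2l//; apply: (@le_trans _ _ ((1 - a) ^+ (d + d) ^+ q.+1)).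
  by apply: lerXn2r => //; rewrite nnegrE ?exprn_ge0//; lra.
rewrite -exprM; apply: ler_wiXn2l; [lra|lra|].
have : (n %% d < d)%N by rewrite ltn_mod.
nia.
Qed.

Section QuickReturns.
Context {R : realType} {s : nat}.
Variables (f : 'I_s -> R -> R) (F : R -> R).
Variables (mu : probability (measurableTypeR R) R) (r : R).
Hypothesis s0 : (0 < s)%N.
Hypothesis cf : contracting_family f.
Hypothesis eF : gap_extension f F.
Hypothesis mu1 : mu I01 = 1%E.
Hypothesis decF : exp_decay mu F r.

Local Notation v n := (fine (mu (Lambda_ f n))).
Local Notation T := (extend0 F).
Local Notation mL := (measurable_Lambda cf).

Lemma Lambda_pr_nonincreasing n m : (n <= m)%N -> v m <= v n.
Proof. by move=> nm; apply: pr_le; [exact: mL|exact: mL|exact: Lambda_nested]. Qed.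

Lemma Lambda_iter_extend0 n i x : Lambda_ f (i + n) x ->
  Lambda_ f n (iter i T x).
Proof.
move=> Lx; have Ix := Lambda_sub_I01 cf Lx.
rewrite iter_extend0//; last exact: (F_I01 cf eF).
by rewrite (iterF_iterG cf eF Lx) ?leq_addr//; apply/Lambda_iterG.
Qed.

Lemma Lambda_iter_extend0_inv m i x : Lambda_ f m x -> (i <= m)%N ->
  Lambda_ f m (iter i T x) -> Lambda_ f (i + m) x.
Proof.
move=> Lx im; rewrite iter_extend0; [|exact: (F_I01 cf eF)|exact: (Lambda_sub_I01 cf Lx)].
by rewrite (iterF_iterG cf eF Lx im) => /Lambda_iterG.
Qed.

Let decay_Lambda : exists2 C : R, 0 < C & forall p n i, (0 < i)%N ->
  fine (mu (Lambda_ f p `&` iter i T @^-1` Lambda_ f n)) <=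
    v n * (v p + C * r ^+ i * s%:R ^+ p).
Proof.
have mF := measurable_F cf eF; have F01 := F_I01 cf eF.
have [C C0 hC] := decay_indic mu1 F01 mF decF.
exists (C * 3); first by rewrite mulr_gt0.
move=> p n i i0; have := hC _ _ _ i (mL p) (mL n) i0 (BVnorm_Lambda cf p s0).
by rewrite ler_norml => /andP[_ h]; lra.
Qed.

Hypothesis v_cvg0 : v n @[n --> \oo] --> 0.

Let r01 : 0 < r < 1. Proof. by case: decF => C _ []. Qed.

Let small_power (e c : R) : 0 < e -> 0 <= c ->
  exists2 N, (0 < N)%N & forall n, (N <= n)%N -> r ^+ n * c <= e.
Proof.
move=> e0 c0; have /andP[r0 r1] := r01; have rn : `|r| < 1 by rewrite ger0_norm; lra.
have := @cvg_geometric R c r rn.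
move=> /cvgrPdist_le /(_ e e0) [N _ hN]; exists N.+1 => // n Nn.
have := hN n (ltnW Nn); rewrite sub0r normrN /geometric/= mulrC ger0_norm//.
by rewrite mulr_ge0// exprn_ge0//; lra.
Qed.

(** Among the points that stay [i + p] steps in the hole, the two ends of the
    orbit are nearly independent, so [d = i + p] further steps halve the
    measure once [v p] is small. *)
Lemma Lambda_halving :
  exists2 d, (0 < d)%N & forall n, v n <= 2^-1 ^+ (n %/ d).
Proof.
have [C C0 hC] := decay_Lambda.
have [p hp] : exists p, v p <= 4^-1.
  move/cvgrPdist_le : v_cvg0 => /(_ 4^-1); case; first by rewrite invr_gt0.
  move=> p _ hp; exists p; move: (hp p (leqnn p)).
  by rewrite /= sub0r normrN ger0_norm ?pr_ge0.
have sp0 : 0 <= C * s%:R ^+ p by rewrite mulr_ge0 ?exprn_ge0// ltW.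
have e4 : (0 : R) < 4^-1 by rewrite invr_gt0.
have [i i0 hi] := small_power e4 sp0.
pose d := (i + p)%N.
have mF := measurable_F cf eF.
have step n : v (d + n) <= v n * 2^-1.
  apply: le_trans (_ : _ <= fine (mu (Lambda_ f p `&` iter d T @^-1` Lambda_ f n))) _.
    apply: pr_le; first exact: mL.
      apply: measurableI; first exact: mL.
      exact: (measurable_preimage_iter (measurable_extend0 mF) _ (mL n)).
    move=> x Lx; split; last exact: Lambda_iter_extend0.
    by apply: Lambda_nested Lx => //; rewrite /d; lia.
  apply: le_trans (hC p n d _) _; first by rewrite /d; lia.
  apply: ler_wpM2l; first exact: pr_ge0.
  have := hi d (leq_addr _ _); lra.
have d0 : (0 < d)%N by rewrite /d; lia.
exists d => // n; apply: (@le_trans _ _ (v (n %/ d * d)%N)).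
  by apply: Lambda_pr_nonincreasing; exact: leq_trunc_div.
elim: (n %/ d)%N => [|q ih]; first by rewrite expr0 pr_le1//; exact: mL.
by rewrite mulSn; apply: le_trans (step _) _; rewrite exprSr ler_wpM2r.
Qed.

(** A point of [Lambda_ m] outside [Lambda_ (k + m)] is not in [Lambda_ m] at any
    positive multiple [i <= m] of [k]. For [i > m] the first event is enlarged to
    [Lambda_ p] with [p] at most a small multiple of [i], for which the mixing
    rate beats the growth of the variation of the indicator. *)
Lemma quick_returns : exists K sigma : R, [/\ 0 <= K, 0 < sigma < 1 &
  forall m k j, (0 < k)%N -> (0 < j)%N ->
    fine (mu ((Lambda_ f m `\` Lambda_ f (k + m)) `&`
              iter j (iter k T) @^-1` Lambda_ f m)) <=
      v m * (v m + K * sigma ^+ m * sigma ^+ j)].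
Proof.
have [C C0 hC] := decay_Lambda; have [d d0 hd] := Lambda_halving.
have e2 : (0 : R) < 2^-1 by rewrite invr_gt0.
have [c c0 /(_ c (leqnn c)) hc] := small_power e2 (ler0n R s).
have cd0 : (0 < c * d)%N by rewrite muln_gt0 c0.
have [K [rho [K0 /andP[rho0 rho1] hK]]] := @halving_geometric R _ cd0.
exists ((1 + C) * K), rho; split; [by rewrite mulr_ge0//; lra|by rewrite rho0|].
move=> m k j k0 j0; set i := (j * k)%N.
have i0 : (0 < i)%N by rewrite muln_gt0 j0.
have mF := measurable_F cf eF.
have -> : iter j (iter k T) = iter i T by apply/funext => x; rewrite /i iterM.
have mT : measurable (iter i T @^-1` Lambda_ f m).
  exact: (measurable_preimage_iter (measurable_extend0 mF) _ (mL m)).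
have [im|mi] := leqP i m.
  rewrite (_ : _ `&` _ = set0).
    rewrite measure0 mulr_ge0 ?pr_ge0// addr_ge0 ?pr_ge0// !mulr_ge0 ?exprn_ge0 ?ltW//.
    by lra.
  apply/seteqP; split=> // x [[Lx nLx] Tx]; apply: nLx.
  apply: (Lambda_nested cf) (Lambda_iter_extend0_inv Lx im Tx).
  by rewrite leq_add2r /i leq_pmull.
(* p <= i / c makes r ^ i * s ^ p at most (r ^ c * s) ^ (i / c) *)
pose p := minn m (i %/ c).
apply: le_trans (_ : _ <= fine (mu (Lambda_ f p `&` iter i T @^-1` Lambda_ f m))) _.
  apply: pr_le.
  - by apply: measurableI => //; apply: measurableD; exact: mL.
  - by apply: measurableI => //; exact: mL.
  - move=> x [[Lx _] Tx]; split => //; apply: Lambda_nested Lx => //.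
    exact: geq_minl.
apply: le_trans (hC p m i i0) _; apply: ler_wpM2l; first exact: pr_ge0.
pose h : R := 2^-1 ^+ (i %/ (c * d)).
have vp : v p <= v m + h.
  rewrite /p; case: (leqP m (i %/ c)) => _.
    by rewrite lerDl exprn_ge0// ltW.
  by apply: le_trans (hd _) _; rewrite -divnMA lerDr pr_ge0.
have /andP[/ltW r0 /ltW r1] := r01.
have s1 : (1 : R) <= s%:R by rewrite ler1n.
have rs : r ^+ i * s%:R ^+ p <= h.
  apply: (@le_trans _ _ ((r ^+ c * s%:R) ^+ (i %/ c))).
    rewrite exprMn -exprM; apply: ler_pM; rewrite ?exprn_ge0//.
      apply: ler_wiXn2l => //.
      by rewrite mulnC leq_trunc_div.
    by apply: ler_weXn2l => //; exact: geq_minr.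
  apply: (@le_trans _ _ (2^-1 ^+ (i %/ c))).
    by apply: lerXn2r; rewrite ?nnegrE ?mulr_ge0 ?exprn_ge0// ltW.
  apply: ler_wiXn2l; [exact: ltW|lra|].
  by rewrite divnMA leq_div.
have hi := hK i; rewrite -/h in hi.
have rm : rho ^+ i <= rho ^+ m.
  by apply: ler_wiXn2l; [exact: ltW|exact: ltW|exact: ltnW].
have rj : rho ^+ i <= rho ^+ j.
  by apply: ler_wiXn2l; [exact: ltW|exact: ltW|rewrite /i leq_pmulr].
have rr : rho ^+ i * rho ^+ i <= rho ^+ m * rho ^+ j.
  by apply: ler_pM => //; rewrite exprn_ge0// ltW.
have hm : h <= K * (rho ^+ m * rho ^+ j).
  by apply: le_trans hi _; rewrite ler_pM2l.
have h1 : C * (r ^+ i * s%:R ^+ p) <= C * h by rewrite ler_pM2l.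
have h2 : (1 + C) * h <= (1 + C) * (K * (rho ^+ m * rho ^+ j)).
  by rewrite ler_pM2l// addr_gt0.
clear -vp h1 h2 rs; rewrite -!mulrA.
lra.
Qed.

End QuickReturns.

(** * Estimate for the avoidance of a hole *)

Lemma geometric_sum_le (R : realFieldType) (sigma : R) p : 0 < sigma < 1 ->
  \sum_(j < p) sigma ^+ j.+1 <= (1 - sigma)^-1.
Proof.
move=> /andP[s0 s1]; have s1' : 0 < 1 - sigma by lra.
rewrite -[leRHS]mul1r ler_pdivlMr//.
suff -> : (\sum_(j < p) sigma ^+ j.+1) * (1 - sigma) = sigma - sigma ^+ p.+1.
  by have := exprn_ge0 p.+1 (ltW s0); lra.
elim: p => [|p ih]; first by rewrite big_ord0 mul0r expr1 subrr.
by rewrite big_ord_recr/= mulrDl ih !exprS; ring.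
Qed.

Section Estimate.
Context {R : realType} {s : nat}.
Variables (f : 'I_s -> R -> R) (F : R -> R).
Variables (mu : probability (measurableTypeR R) R) (r : R).
Hypothesis s0 : (0 < s)%N.
Hypothesis cf : contracting_family f.
Hypothesis eF : gap_extension f F.
Hypothesis mu1 : mu I01 = 1%E.
Hypothesis invF : invariant_measure mu F.
Hypothesis decF : exp_decay mu F r.

Local Notation v n := (fine (mu (Lambda_ f n))).
Local Notation T := (extend0 F).
Local Notation mL := (measurable_Lambda cf).

(** The points of [Lambda_ m] that do not come back to [Lambda_ m] at the times
    [k, 2 * k, ..., q * k]. *)
Definition no_return (m k q : nat) : set (measurableTypeR R) :=
  [set x | Lambda_ f m x /\
           forall j, (1 <= j <= q)%N -> ~ Lambda_ f m (iter j (iter k T) x)].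

Let mF := measurable_F cf eF.
Let mT := measurable_extend0 mF.
Let invT := invariant_extend0 mu1 mF invF.

Let mTk k : measurable_fun setT (iter k T).
Proof. exact: measurable_fun_iter. Qed.

Let invTk k A : measurable A -> mu (iter k T @^-1` A) = mu A.
Proof. exact: (measure_preimage_iter mT invT). Qed.

Lemma measurable_no_return m k q : measurable (no_return m k q).
Proof.
have -> : no_return m k q = Lambda_ f m `&`
    \bigcap_(j in `I_q) ~` (iter j.+1 (iter k T) @^-1` Lambda_ f m).
  apply/seteqP; split=> x [Lx h]; split=> // j.
    by move=> jq; apply: h; rewrite ltnS leq0n.
  by case: j => [//|j] jq; exact: h.
apply: measurableI; first exact: mL.
apply: fin_bigcap_measurable => [|j _]; first exact: finite_II.
by apply: measurableC; apply: (measurable_preimage_iter (mTk k)); exact: mL.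
Qed.

Lemma Lambda_setD_pr m k :
  fine (mu (Lambda_ f m `\` Lambda_ f (k + m))) = v m - v (k + m).
Proof.
rewrite (prDI mu (mL m) (mL (k + m))) setIidr ?addrK//.
by apply: Lambda_nested => //; exact: leq_addl.
Qed.

(** The measure of the set of points whose first [N] iterates under [iter k T]
    avoid the hole [Lambda_ m]. The gap [t] and the return horizon [q] are
    free parameters. *)
Lemma avoid_estimate : v n @[n --> \oo] --> 0 ->
  exists C K sigma : R, [/\ 0 <= C, 0 <= K, 0 < sigma < 1 &
  forall m k q t N b, (0 < k)%N -> (0 < q)%N -> (0 < t)%N ->
    (BVnorm (\1_(no_return m k q) : R -> R) <= b%:E)%E ->
    `|fine (mu (avoid (iter k T) (Lambda_ f m) N))
      - (1 - fine (mu (Lambda_ f m `\` Lambda_ f (k + m)))) ^+ N|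
    <= v m + N%:R * (K * sigma ^+ m * v m + (2 * t%:R + q%:R) * v m ^+ 2
                     + C * r ^+ t * b)].
Proof.
move=> v0; have [C C0 hC] := decay_indic mu1 (F_I01 cf eF) mF decF.
have [K [sg [K0 sg01 hK]]] := quick_returns s0 cf eF mu1 decF v0.
have /andP[sg0 sg1] := sg01.
have i1 : 0 < (1 - sg)^-1 by rewrite invr_gt0 subr_gt0.
exists C, (2 * (K * (1 - sg)^-1)), sg; split => //; first exact: ltW.
  by rewrite !mulr_ge0// ltW.
move=> m k q t N b k0 q0 t0 Ab.
set U := Lambda_ f m; set Q := Lambda_ f m `\` Lambda_ f (k + m).
set A := no_return m k q.
have mU : measurable (U : set (measurableTypeR R)) by exact: mL.
have mQ : measurable (Q : set (measurableTypeR R)) by apply: measurableD; exact: mL.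
have mA : measurable A by exact: measurable_no_return.
have mret j B : measurable B -> measurable (iter j (iter k T) @^-1` B).
  exact: (measurable_preimage_iter (mTk k)).
have QU : Q `<=` U by move=> x [].
have AQ : A `<=` Q.
  move=> x [Ux h]; split => // Lx; apply: (h 1%N); first by rewrite q0.
  exact: (Lambda_iter_extend0 cf eF).
have UT : U `\` Q `<=` iter k T @^-1` U.
  move=> x [Ux nQ]; apply: (Lambda_iter_extend0 cf eF).
  by apply: contrapT => nL; exact: nQ.
have returns p : \sum_(j < p) fine (mu (Q `&` iter j.+1 (iter k T) @^-1` U)) <=
    v m * (p%:R * v m + K * sg ^+ m * (1 - sg)^-1).
  apply: (@le_trans _ _ (\sum_(j < p) v m * (v m + K * sg ^+ m * sg ^+ j.+1))).
    by apply: ler_sum => j _; exact: hK.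
  rewrite -mulr_sumr; apply: ler_wpM2l; first exact: pr_ge0.
  rewrite big_split/= sumr_const card_ord.
  rewrite -[X in X + _ <= _]mulr_natl lerD2l -mulr_sumr.
  apply: ler_wpM2l; last exact: geometric_sum_le.
  by rewrite mulr_ge0// exprn_ge0// ltW.
have QA : fine (mu (Q `\` A)) <= v m * (q%:R * v m + K * sg ^+ m * (1 - sg)^-1).
  apply: le_trans (returns q).
  apply: (@pr_union_bound _ _ _ mu _ (fun j => Q `&` iter j.+1 (iter k T) @^-1` U)).
  - exact: measurableD.
  - by move=> j; apply: measurableI => //; exact: mret.
  move=> x [Qx nA]; apply: contrapT => nex; apply: nA; split; first exact: QU.
  move=> [//|j] jq Uj; apply: nex; exists j => //.
have r01 : 0 < r < 1 by case: decF => ? _ [].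
have /andP[r0 r1] := r01.
have b0 : 0 <= b by rewrite -lee_fin; apply: le_trans Ab; exact: BVnorm_indic_ge0.
have mix V : measurable V ->
    `|fine (mu (A `&` iter t (iter k T) @^-1` V)) - fine (mu A) * fine (mu V)|
      <= C * r ^+ t * b.
  move=> mV; have -> : iter t (iter k T) = iter (t * k) T.
    by apply/funext => x; rewrite iterM.
  apply: le_trans (hC _ _ b (t * k)%N mA mV _ Ab) _; first by rewrite muln_gt0 t0.
  apply: (@le_trans _ _ (C * r ^+ (t * k) * b)).
    rewrite -[leRHS]mulr1 ler_wpM2l ?pr_le1//.
    by rewrite !mulr_ge0 ?exprn_ge0// ltW.
  rewrite ler_wpM2r// ler_pM2l//.
  by apply: ler_wiXn2l; [exact: ltW|exact: ltW|exact: leq_pmulr].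
apply: le_trans (pr_avoid_approx (mTk k) (@invTk k) N mU mQ mA AQ QU UT t0 mix) _.
rewrite lerD2l ler_wpM2l//.
have S1 : \sum_(j < t.-1) fine (mu (Q `&` iter j.+1 (iter k T) @^-1` Q)) <=
    v m * (t%:R * v m + K * sg ^+ m * (1 - sg)^-1).
  apply: (@le_trans _ _ (v m * (t.-1%:R * v m + K * sg ^+ m * (1 - sg)^-1))).
    apply: le_trans (returns t.-1); apply: ler_sum => j _.
    apply: pr_le; [by apply: measurableI => //; exact: mret| |].
      by apply: measurableI => //; exact: mret.
    by move=> x [Qx Qj]; split => //; exact: QU.
  apply: ler_wpM2l; first exact: pr_ge0.
  by rewrite lerD2r ler_wpM2r ?pr_ge0// ler_nat leq_pred.
have QU2 : t%:R * fine (mu Q) ^+ 2 <= t%:R * v m ^+ 2.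
  rewrite ler_wpM2l// lerXn2r ?nnegrE ?pr_ge0//.
  exact: pr_le.
clear -S1 QU2 QA; rewrite /U in S1 QU2 QA *.
lra.
Qed.

End Estimate.

Section Observable.
Context {R : realType} {s : nat}.
Variables (f : 'I_s -> R -> R) (F : R -> R) (k : nat).
Hypothesis cf : contracting_family f.
Hypothesis eF : gap_extension f F.

Local Notation X := (fun j x => phi f (iter j (iter k F) x)).

Let iter_iterF j x : I01 x ->
  iter j (iter k F) x = iter j (iter k (extend0 F)) x.
Proof. by move=> Ix; rewrite -!iterM iter_extend0//; exact: (F_I01 cf eF). Qed.

Let le_phi n x : (phi f x <= n%:R%:E)%E <-> ~ Lambda_ f n x.
Proof.
rewrite leNgt; split=> [/negP h /(lt_phi cf)//|h].
by apply/negP => /(lt_phi cf).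
Qed.

Lemma escape_no_return q m : escape X q m%:R%:E = no_return f F m k q.
Proof.
apply/seteqP; split=> x.
  move=> [Ix /(lt_phi cf) Lx h]; split=> // j jq.
  by rewrite -iter_iterF//; apply/le_phi; exact: h.
move=> [Lx h]; have Ix := Lambda_sub_I01 cf Lx; split=> //.
  exact/(lt_phi cf).
by move=> j jq; apply/le_phi; rewrite iter_iterF//; exact: h.
Qed.

Lemma max_le_avoid N m :
  [set x | I01 x /\ (M X N x <= m%:R%:E)%E] =
  avoid (iter k (extend0 F)) (Lambda_ f m) N `&` I01.
Proof.
apply/seteqP; split=> x [].
  move=> Ix h; split=> // j jN; rewrite -iter_iterF//; apply/le_phi.
  apply: le_trans h.
  by rewrite /M (bigD1 (Ordinal jN))//= le_max lexx.
move=> h Ix; split=> //; apply: bigmax_le; first exact: leNye.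
by move=> j _; apply/le_phi; rewrite iter_iterF//; exact: h.
Qed.

End Observable.


(** * Limits *)

(** By [1 + x <= expR x] at [x = - a] and at [x = a / (1 - a)], the power lies
    between [expR (- (w * a / (1 - a)))] and [expR (- (w * a))]. *)
Lemma cvg_pow_expR (R : realType) (a : nat -> R) (w : nat -> nat) (l : R) :
    (forall n, 0 <= a n) -> a n @[n --> \oo] --> 0 ->
    (w n)%:R * a n @[n --> \oo] --> l ->
  (1 - a n) ^+ w n @[n --> \oo] --> expR (- l).
Proof.
move=> a0 ca cwa.
have c1 : 1 - a n @[n --> \oo] --> (1 : R).
  by rewrite -[X in _ --> X]subr0; apply: cvgB => //; exact: cvg_cst.
apply: (squeeze_cvgr (f := fun n => expR (- ((w n)%:R * a n * (1 - a n)^-1)))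
   (h := fun n => expR (- ((w n)%:R * a n)))).
- have : \forall n \near \oo, a n < 1.
    move/cvgrPdist_lt : ca => /(_ 1 ltr01); apply: filterS => n.
    by rewrite sub0r normrN ger0_norm.
  apply: filterS => n a1; have a1' : 0 < 1 - a n by lra.
  apply/andP; split.
    rewrite -mulrA -mulrN expRM_natl lerXn2r ?nnegrE ?expR_ge0 ?(ltW a1')//.
    rewrite expRN invf_ple ?posrE ?expR_gt0//.
    apply: le_trans (expR_ge1Dx _).
    by rewrite le_eqVlt; apply/orP; left; apply/eqP; field; lra.
  rewrite -mulrN expRM_natl lerXn2r ?nnegrE ?expR_ge0 ?(ltW a1')//.
  exact: expR_ge1Dx.
- apply: (@cvg_comp _ _ _ _ expR _ (nbhs (- l))); last exact: continuous_expR.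
  apply: cvgN; rewrite -[X in _ --> X]mulr1; apply: cvgM => //.
  by rewrite -[X in _ --> X]invr1; apply: cvgV => //; exact: oner_neq0.
- apply: (@cvg_comp _ _ _ _ expR _ (nbhs (- l))); last exact: continuous_expR.
  exact: cvgN.
Qed.

Section Limits.
Context {R : realType}.
Implicit Types (v a p : nat -> R) (w q : nat -> nat).

(** If [v] does not tend to [0] through positive values, then [w n] is eventually
    [0] and [theta = 0]. Either [v] vanishes eventually, and the inverses are [0]
    by convention; or [v] is bounded away from [0], so [w] is bounded, and
    [q n / w n --> 0] with [q n --> \oo] leaves only [w n = 0], where the quotient
    is [0] by convention. *)
Lemma degenerate_limits v q (tau theta : R) k :
    (forall n, 0 <= v n) -> {homo v : n m / (n <= m)%N >-> m <= n} ->
    0 < tau -> q n @[n --> \oo] --> \oo ->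
    let w n := Num.truncn (tau * (v (n + k)%N)^-1) in
    (q n)%:R / (w n)%:R @[n --> \oo] --> (0 : R) ->
    (v (n + k)%N - v (k.+1 + (n + k))%N) / v (n + k)%N @[n --> \oo] --> theta ->
    ~ ((forall n, 0 < v n) /\ v n @[n --> \oo] --> (0 : R)) ->
  (\forall n \near \oo, w n = 0%N) /\ theta = 0.
Proof.
move=> v0 vd tau0 qoo w cqw cth nreg.
have cv0 : v n @[n --> \oo] --> inf (range v).
  by apply: nonincreasing_cvgn => //; exists 0 => _ [n _ <-].
set L := inf (range v) in cv0.
have Lv n : L <= v n.
  by apply: ge_inf; [exists 0 => _ [j _ <-]|exists n].
have uniq0 u : u n @[n --> \oo] --> theta -> u n @[n --> \oo] --> (0 : R) -> theta = 0.
  by move=> h1 h2; apply: (cvg_unique _ h1 h2).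
have [vpos|/existsNP[p /negP]] := pselect (forall n, 0 < v n); last first.
  rewrite lt_neqAle v0 andbT negbK => /eqP vp.
  have vz n : (p <= n)%N -> v n = 0.
    by move=> pn; apply/eqP; rewrite eq_le v0 vp vd.
  have nearz : \forall n \near \oo, v (n + k)%N = 0.
    by exists p => // n /= pn; apply: vz; lia.
  split; first by apply: filterS nearz => n vn; rewrite /w vn invr0 mulr0 truncn0.
  apply: uniq0 cth _; apply: cvg_near_cst.
  by apply: filterS nearz => n ->; rewrite invr0 mulr0.
have L0 : 0 < L.
  rewrite lt_neqAle; apply/andP; split.
    by apply/eqP => L0; apply: nreg; split=> //; rewrite L0.
  apply: lb_le_inf; first by exists (v 0%N), 0%N.
  by move=> _ [n _ <-].
split.
  (* w is bounded, so q <= w fails eventually *)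
  move/cvgnyPgt : qoo => /(_ (Num.truncn (tau / L))) qbig.
  move/cvgrPdist_lt : cqw => /(_ 1 ltr01) qw.
  apply: filterS2 qbig qw => n qL; rewrite sub0r normrN ger0_norm ?divr_ge0// => qw1.
  apply/eqP; rewrite -leqn0 leqNgt; apply/negP => wn.
  move: qw1; rewrite ltr_pdivrMr ?ltr0n// mul1r ltr_nat => qwn.
  have : (w n <= Num.truncn (tau / L))%N.
    apply: le_truncn; rewrite ler_pM2l// lef_pV2 ?posrE//.
  lia.
apply: uniq0 cth _.
have -> : (0 : R) = (L - L) / L by rewrite subrr mul0r.
apply: cvgM; last first.
  apply: cvgV; first by rewrite gt_eqF.
  by rewrite (cvg_shiftn k v).
apply: cvgB; first by rewrite (cvg_shiftn k v).
rewrite (_ : (fun n => v (k.+1 + (n + k))%N) = (fun n => v (n + (k.+1 + k))%N)).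
  by rewrite (cvg_shiftn (k.+1 + k) v).
by apply/funext => n; rewrite addnCA.
Qed.

(** The passage to the limit in an estimate such as [avoid_estimate]: [v n] is the
    measure of the hole, [a n] that of the escaping points, [b n] a BV norm, and
    [g n] an exponentially small factor. *)
Lemma exponential_limit v a p w q (t b g : nat -> R) (C K r tau theta : R) :
    0 <= C -> 0 <= K -> 0 < r < 1 -> 0 < tau ->
    (forall n, 0 < v n) -> v n @[n --> \oo] --> (0 : R) ->
    (forall n, w n = Num.truncn (tau * (v n)^-1)) ->
    (forall n, 0 <= a n <= v n) -> a n / v n @[n --> \oo] --> theta ->
    g n @[n --> \oo] --> (0 : R) -> (forall n, 0 <= g n) ->
    t =o_\oo (fun n => (w n)%:R : R) ->
    (q n)%:R / (w n)%:R @[n --> \oo] --> (0 : R) ->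
    (forall n, 0 <= b n) ->
    b n * ((w n)%:R * r `^ t n) @[n --> \oo] --> (0 : R) ->
    (\forall n \near \oo, forall j, (0 < j)%N ->
      `|p n - (1 - a n) ^+ w n| <=
        v n + (w n)%:R * (K * g n * v n + (2 * j%:R + (q n)%:R) * v n ^+ 2
                          + C * r ^+ j * b n)) ->
  p n @[n --> \oo] --> expR (- (theta * tau)).
Proof.
move=> C0 K0 /andP[r0 r1] tau0 v0 cv wE a0v ca cg g0 tw cq b0 cb est.
have wv n : (w n)%:R * v n <= tau.
  by rewrite -ler_pdivlMr// wE truncn_le// divr_ge0 ?ltW.
have wv' n : tau - v n <= (w n)%:R * v n.
  have := truncnS_gt (tau * (v n)^-1); rewrite -wE -natr1 ltr_pdivrMr// mulrDl mul1r.
  by lra.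
have wpos : \forall n \near \oo, (0 < w n)%N.
  move/cvgrPdist_le : cv => /(_ tau tau0); apply: filterS => n.
  rewrite sub0r normrN gtr0_norm// => vt.
  by rewrite wE truncn_gt0 ler_pdivlMr// mul1r.
have cwv : (w n)%:R * v n @[n --> \oo] --> tau.
  apply: (squeeze_cvgr (f := fun n => tau - v n) (h := fun=> tau)).
  - by apply: nearW => n; rewrite wv' wv.
  - by rewrite -[X in _ --> X]subr0; apply: cvgB => //; exact: cvg_cst.
  - exact: cvg_cst.
have ca0 : a n @[n --> \oo] --> (0 : R).
  apply: (squeeze_cvgr (f := fun=> 0) (h := v)) => //; last exact: cvg_cst.
  exact: nearW.
have cwa : (w n)%:R * a n @[n --> \oo] --> theta * tau.
  rewrite mulrC; have -> : (fun n => (w n)%:R * a n) =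
      (fun n => (w n)%:R * v n * (a n / v n)).
    by apply/funext => n; field; rewrite gt_eqF.
  exact: cvgM.
have cpow := cvg_pow_expR (fun n => (andP (a0v n)).1) ca0 cwa.
have ctw : `|t n| / (w n)%:R @[n --> \oo] --> (0 : R).
  apply/cvgrPdist_le => e e0; move/eqoP : tw => /(_ e e0) te.
  apply: filterS2 wpos te => n wn; rewrite sub0r normrN.
  rewrite [`|(w n)%:R|]ger0_norm// => te.
  by rewrite ger0_norm ?divr_ge0// ler_pdivrMr ?ltr0n.
pose e n := v n + (K * tau * g n
  + tau * (2 * (`|t n| / (w n)%:R * tau + v n) + (q n)%:R / (w n)%:R * tau)
  + C * (b n * ((w n)%:R * r `^ t n))).
have ce : e n @[n --> \oo] --> (0 : R).
  have -> : (0 : R) = 0 + (K * tau * 0 + tau * (2 * (0 * tau + 0) + 0 * tau) + C * 0).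
    by ring.
  apply: cvgD => //; apply: cvgD; last by apply: cvgM => //; exact: cvg_cst.
  apply: cvgD; first by apply: cvgM => //; exact: cvg_cst.
  apply: cvgM; first exact: cvg_cst.
  apply: cvgD; last by apply: cvgM => //; exact: cvg_cst.
  apply: cvgM; first exact: cvg_cst.
  by apply: cvgD => //; apply: cvgM => //; exact: cvg_cst.
have bound : \forall n \near \oo, `|p n - (1 - a n) ^+ w n| <= e n.
  apply: filterS2 wpos est => n wn.
  (* any integer gap at least as large as t n will do *)
  set j := (Num.truncn `|t n|).+1.
  move=> /(_ j isT) /le_trans; apply; rewrite /e lerD2l.
  have wn0 : (0 : R) < (w n)%:R by rewrite ltr0n.
  have jt : j%:R <= `|t n| + 1 by rewrite /j -natr1 lerD2r truncn_le.
  have tj : t n <= j%:R.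
    by apply: le_trans (ler_norm _) _; apply/ltW/truncnS_gt.
  have rj : r ^+ j <= r `^ t n.
    by rewrite -powR_mulrn ?(ltW r0)// ger_powR// r0 ltW.
  have vn := v0 n.
  have jv : j%:R * v n <= `|t n| / (w n)%:R * tau + v n.
    apply: (@le_trans _ _ ((`|t n| + 1) * v n)); first by rewrite ler_pM2r.
    rewrite mulrDl mul1r lerD2r mulrAC ler_pdivlMr// -mulrA.
    by rewrite ler_wpM2l// mulrC.
  have qv : (q n)%:R * v n <= (q n)%:R / (w n)%:R * tau.
    by rewrite mulrAC ler_pdivlMr// -mulrA ler_wpM2l// mulrC.
  rewrite mulrDr mulrDr; apply: lerD; first apply: lerD.
  - have -> : (w n)%:R * (K * g n * v n) = K * g n * ((w n)%:R * v n) by ring.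
    have -> : K * tau * g n = K * g n * tau by ring.
    by rewrite ler_wpM2l// mulr_ge0.
  - have -> : (w n)%:R * ((2 * j%:R + (q n)%:R) * v n ^+ 2) =
      (w n)%:R * v n * (2 * (j%:R * v n) + (q n)%:R * v n) by ring.
    apply: ler_pM => //.
    + by rewrite mulr_ge0// ltW.
    + by rewrite addr_ge0// ?mulr_ge0// ltW.
    + by apply: lerD => //; rewrite ler_pM2l.
  - have -> : (w n)%:R * (C * r ^+ j * b n) = C * (b n * ((w n)%:R * r ^+ j)) by ring.
    by rewrite !ler_wpM2l.
have cd : p n - (1 - a n) ^+ w n @[n --> \oo] --> (0 : R).
  apply/cvgrPdist_le => d d0; move/cvgrPdist_le : ce => /(_ d d0) ed.
  apply: filterS2 bound ed => n pe; rewrite !sub0r !normrN => ed.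
  by apply: le_trans pe _; apply: le_trans ed; exact: ler_norm.
rewrite (_ : (fun n => p n) = (fun n => p n - (1 - a n) ^+ w n) \+
    (fun n => (1 - a n) ^+ w n)); last first.
  by apply/funext => n /=; rewrite subrK.
by rewrite -[X in _ --> X]add0r; exact: cvgD.
Qed.

End Limits.

Theorem theorem4p2 (R : realType) (s : nat) (f : 'I_s -> R -> R) (F : R -> R)
    (mu : probability (measurableTypeR R) R) (r : R) (k : nat)
    (tau theta : R) (t : nat -> R) (q : nat -> nat) :
  let T := iter k F in
  let X := fun (j : nat) (x : R) => phi f (iter j T x) in
  let u := fun n : nat => ((n + k - 1)%N%:R : R)%:E in
  let w := fun n : nat =>
    Num.truncn (tau * (fine (mu (Lambda_ f (n + k - 1))))^-1) in
  (0 < s)%N ->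
  contracting_family f ->
  gap_extension f F ->
  mu I01 = 1%E ->
  invariant_measure mu F ->
  mu `<< @lebesgue_measure R ->
  exp_decay mu F r ->
  (0 < k)%N ->
  0 <= tau ->
  t =o_\oo (fun n => (w n)%:R : R) ->
  (forall n, (0 < n)%N -> (0 < q n)%N) ->
  q n @[n --> \oo] --> \oo ->
  (q n)%:R / (w n)%:R @[n --> \oo] --> (0 : R) ->
  (BVnorm \1_(escape X (q n) (u n)) * ((w n)%:R * r `^ t n)%:E)%E
    @[n --> \oo] --> 0%E ->
  (BVnorm \1_(exceedance X (u n)) * (r ^+ q n)%:E)%E @[n --> \oo] --> 0%E ->
  0 <= theta <= 1 ->
  fine (mu (Lambda_ f (n + k - 1) `\` Lambda_ f (n + 2 * k - 1)))
    / fine (mu (Lambda_ f (n + k - 1))) @[n --> \oo] --> theta ->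
  mu [set x | I01 x /\ (M X (w n) x <= u n)%E] @[n --> \oo]
    --> (expR (- (theta * tau)))%:E.
Proof.
move=> T X u w s0 cf eF mu1 invF _ decF k0 tau0 tw q0 qoo cqw cA _ _ cth.
have mL := measurable_Lambda cf.
case: k k0 => // k _ in T X u w tw cqw cA cth *.
pose v n := fine (mu (Lambda_ f n)).
have mE n : (n + k.+1 - 1 = n + k)%N by rewrite addnS subn1.
have mE2 n : (n + 2 * k.+1 - 1 = k.+1 + (n + k))%N by lia.
have v0 n : 0 <= v n by exact: pr_ge0.
have vd : {homo v : n m / (n <= m)%N >-> m <= n}.
  by move=> n m nm; exact: Lambda_pr_nonincreasing.
have wE n : w n = Num.truncn (tau * (v (n + k)%N)^-1) by rewrite /w mE.
have cth' : (v (n + k)%N - v (k.+1 + (n + k))%N) / v (n + k)%N @[n --> \oo] --> theta.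
  rewrite (_ : (fun n => _) = (fun n =>
      fine (mu (Lambda_ f (n + k.+1 - 1) `\` Lambda_ f (n + 2 * k.+1 - 1)))
        / fine (mu (Lambda_ f (n + k.+1 - 1)))))//.
  by apply/funext => n; rewrite mE mE2 (Lambda_setD_pr mu cf).
have mset n : mu [set x | I01 x /\ (M X (w n) x <= u n)%E] =
    mu (avoid (iter k.+1 (extend0 F)) (Lambda_ f (n + k)) (w n)).
  have mT := measurable_extend0 (measurable_F cf eF).
  rewrite /X /T /u mE (max_le_avoid k.+1 cf eF) mu_setI01//.
  by apply: measurable_avoid => //; exact: measurable_fun_iter.
have mav n : measurable (avoid (iter k.+1 (extend0 F)) (Lambda_ f (n + k)) (w n)
    : set (measurableTypeR R)).
  apply: measurable_avoid => //; apply: measurable_fun_iter.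
  exact: measurable_extend0 (measurable_F cf eF).
rewrite (_ : (fun n => _) = (fun n => (fine (mu (avoid (iter k.+1 (extend0 F))
    (Lambda_ f (n + k)) (w n))))%:E)); last first.
  by apply/funext => n; rewrite mset pr_fin.
apply: cvg_EFin; first exact: nearW.
(* without observations the event is everything *)
have degenerate : (\forall n \near \oo, w n = 0%N) -> theta * tau = 0 ->
    fine (mu (avoid (iter k.+1 (extend0 F)) (Lambda_ f (n + k)) (w n)))
      @[n --> \oo] --> expR (- (theta * tau)).
  move=> wz ->; rewrite oppr0 expR0; apply: cvg_near_cst.
  by apply: filterS wz => n ->; rewrite avoid0 probability_setT.
have [tau00|taun0] := eqVneq tau 0.
  apply: degenerate; last by rewrite tau00 mulr0.
  by apply: nearW => n; rewrite wE tau00 mul0r truncn0.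
have tau_gt0 : 0 < tau by rewrite lt_neqAle eq_sym taun0.
have wE' : w = fun n => Num.truncn (tau * (v (n + k)%N)^-1) by exact/funext.
have [[vpos cv]|nreg] := pselect ((forall n, 0 < v n) /\ v n @[n --> \oo] --> (0 : R));
    last first.
  rewrite wE' in cqw.
  have [wz th0] := degenerate_limits v0 vd tau_gt0 qoo cqw cth' nreg.
  by apply: degenerate; [rewrite wE'|rewrite th0 mul0r].
have [C [K [sg [C0 K0 /andP[sg0 sg1] est]]]] := avoid_estimate s0 cf eF mu1 invF decF cv.
have /andP[r0 r1] : 0 < r < 1 by case: decF => ? _ [].
have cvk : v (n + k)%N @[n --> \oo] --> (0 : R) by rewrite (cvg_shiftn k v).
have eA n : escape X (q n) (u n) = no_return f F (n + k) k.+1 (q n).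
  by rewrite /X /T /u mE (escape_no_return k.+1 cf eF).
pose b n := fine (BVnorm (\1_(no_return f F (n + k) k.+1 (q n)) : R -> R)).
have wpos : \forall n \near \oo, (0 < w n)%N.
  move/cvgrPdist_le : cvk => /(_ tau tau_gt0); apply: filterS => n.
  rewrite sub0r normrN gtr0_norm// => vt.
  by rewrite wE truncn_gt0 ler_pdivlMr// mul1r.
(* a finite product with a positive factor forces a finite BV norm *)
move/fine_cvgP : cA => [finA cA].
have bE : \forall n \near \oo,
    BVnorm (\1_(no_return f F (n + k) k.+1 (q n)) : R -> R) = (b n)%:E.
  apply: filterS2 wpos finA => n wn; rewrite eA => fA.
  rewrite /b; have := BVnorm_indic_ge0 (no_return f F (n + k) k.+1 (q n)).
  case E : (BVnorm _) => [x| |]//= _; move: fA; rewrite E.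
  by rewrite gt0_mulye// lte_fin mulr_gt0 ?ltr0n ?powR_gt0.
apply: (@exponential_limit _ (fun n => v (n + k)%N)
  (fun n => v (n + k)%N - v (k.+1 + (n + k))%N) _ w q t b
  (fun n => sg ^+ (n + k)) C K r) => //.
- by rewrite r0.
- by move=> n; rewrite lerBlDr lerDl v0 subr_ge0 vd// leq_addl.
- rewrite (cvg_shiftn k (fun n => sg ^+ n)); apply: cvg_expr.
  by rewrite gtr0_norm.
- by move=> n; rewrite exprn_ge0// ltW.
- by move=> n; rewrite fine_ge0// BVnorm_indic_ge0.
- apply: cvg_trans cA; apply: near_eq_cvg; apply: filterS bE => n bn /=.
  by rewrite eA bn -EFinM.
near=> n => j j0.
rewrite -Lambda_setD_pr//; apply: est => //.
- by apply: q0; near: n; exists 1%N.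
- suff -> : BVnorm (\1_(no_return f F (n + k) k.+1 (q n)) : R -> R) = (b n)%:E by [].
  by near: n.
Unshelve. all: by end_near. Qed.
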